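(* Let $r,p\in[1,\infty)$ with $r\le p$. Then for every $d\in\mathbb{N}$, $d\ge 1$, $$Q^{dq}_{|\cdot|_{\ell^r},p,d}\le d^{1/r}\cdot Q^{dq}_{|\cdot|,p,1},$$ where $|\cdot|$ denotes the standard absolute value on $\mathbb{R}$.
   Context: $|x|_{\ell^r}=(|x^1|^r+\cdots+|x^d|^r)^{1/r}$ for $x=(x^1,\ldots,x^d)\in\mathbb{R}^d$. For a norm $\|\cdot\|$ on $\mathbb{R}^d$, $$Q^{dq}_{\|\cdot\|,p,d}=\inf_{n\ge1}n^{1/d}\,d_{n,p}(\mathcal U([0,1]^d)),$$ where $\mathcal U([0,1]^d)$ is the uniform distribution on $[0,1]^d$, and for a probability distribution $\mathbf{P}$ on $\mathbb{R}^d$, $$d_{n,p}(\mathbf{P})=\inf\Big\{\Big(\int F_p(\xi;\Gamma)^p\,\mathbf{P}(d\xi)\Big)^{1/p}:\ \Gamma\subset\mathbb{R}^d \text{ nonempty finite},\ |\Gamma|\le n\Big\},$$ $$F_p(\xi;\Gamma)=\inf\Big\{\Big(\sum_{x\in\Gamma}\lambda_x\|\xi-x\|^p\Big)^{1/p}:\ \lambda_x\in[0,1],\ \sum_{x\in\Gamma}\lambda_x x=\xi,\ \sum_{x\in\Gamma}\lambda_x=1\Big\},\qquad \inf\emptyset=+\infty.$$ *)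

(* Defs.v *)
From HB Require Import structures.
From mathcomp Require Import all_boot all_order all_algebra finmap.
From mathcomp Require Import all_classical all_reals all_analysis.

Set Implicit Arguments.
Unset Strict Implicit.
Unset Printing Implicit Defensive.

Import Order.TTheory GRing.Theory Num.Theory.
Import numFieldNormedType.Exports.

Local Open Scope classical_set_scope.
Local Open Scope ring_scope.

(* R^d is 'rV[R]_d, with the product sigma-algebra: the one generated by the
   coordinate projections, as for n.-tuple in the library. *)
Definition measure_rV_display : measure_display -> measure_display.
Proof. exact. Qed.

Section measurable_rV.
Context {d : measure_display} {T : measurableType d}.
Variable n : nat.

Let coors : 'I_n -> 'rV[T]_n -> T := fun i v => v ord0 i.

Let rV_set0 : g_sigma_preimage coors set0.
Proof. exact: sigma_algebra0. Qed.

Let rV_setC A : g_sigma_preimage coors A -> g_sigma_preimage coors (~` A).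
Proof. exact: sigma_algebraC. Qed.

Let rV_bigcup (F : _^nat) : (forall i, g_sigma_preimage coors (F i)) ->
  g_sigma_preimage coors (\bigcup_i (F i)).
Proof. exact: sigma_algebra_bigcup. Qed.

HB.instance Definition _ := @isMeasurable.Build (measure_rV_display d)
  'rV[T]_n (g_sigma_preimage coors) rV_set0 rV_setC rV_bigcup.

End measurable_rV.

Lemma measurable_coord (d : measure_display) (T : measurableType d) (n : nat)
    (i : 'I_n) : measurable_fun [set: 'rV[T]_n] (fun v => v ord0 i).
Proof.
move=> _ Y mY; rewrite setTI; apply: sub_sigma_algebra => /=.
rewrite -bigcup_seq/=; exists i => /=; first by rewrite mem_index_enum.
by exists Y => //; rewrite setTI.
Qed.

Lemma measurable_fun_coordP (d d' : measure_display) (S : measurableType d)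
    (T : measurableType d') (n : nat) (f : S -> 'rV[T]_n) :
  measurable_fun [set: S] f <->
  forall i, measurable_fun [set: S] (fun s => f s ord0 i).
Proof.
split=> [mf i|mf].
  exact: (measurableT_comp (@measurable_coord _ _ _ i) mf).
move=> _ Y mY; rewrite setTI; move: Y mY.
suff : @measurable _ 'rV[T]_n `<=` image_set_system setT f measurable.
  by move=> sub Y /sub; rewrite /image_set_system /= setTI.
apply: smallest_sub.
  apply: sigma_algebra_image; exact: sigma_algebra_measurable.
rewrite -bigcup_seq; apply: bigcup_sub => i _ A [B mB <-].
by rewrite /image_set_system /= !setTI -[X in measurable X]setTI; exact: mf.
Qed.

Section product_probability.
Context {d1 d2 : measure_display} {T1 : measurableType d1}
  {T2 : measurableType d2} {R : realType}.
Variables (P1 : probability T1 R) (P2 : probability T2 R).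

Definition product_probability : set (T1 * T2) -> \bar R := (P1 \x P2)%E.

HB.instance Definition _ := Measure.on product_probability.

Let product_probabilityT : product_probability setT = 1%E.
Proof.
rewrite /product_probability -setXTT product_measure1E//.
by rewrite -[RHS]mule1; congr (_ * _)%E; exact: probability_setT.
Qed.

HB.instance Definition _ :=
  Measure_isProbability.Build _ _ _ product_probability product_probabilityT.

End product_probability.

Section uniform_cube.
Context {R : realType}.

Definition rV_cons (d : nat) (xv : measurableTypeR R * 'rV[R]_d) :
  'rV[R]_d.+1 :=
  row_mx (const_mx xv.1 : 'rV[R]_1) xv.2.

Lemma rV_cons0 d (xv : measurableTypeR R * 'rV[R]_d) :
  rV_cons xv ord0 ord0 = xv.1.
Proof. by rewrite mxE; case: splitP => // j _; rewrite mxE. Qed.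

Lemma rV_consS d (xv : measurableTypeR R * 'rV[R]_d) (i : 'I_d) :
  rV_cons xv ord0 (lift ord0 i) = xv.2 ord0 i.
Proof.
rewrite mxE; case: splitP => j /= ij; first by have := ltn_ord j; rewrite -ij.
by congr (xv.2 _ _); apply/val_inj; case: ij.
Qed.

Lemma measurable_rV_cons d : measurable_fun setT (@rV_cons d).
Proof.
apply/measurable_fun_coordP => i; case: (unliftP ord0 i) => [j|] ->.
  under eq_fun do rewrite rV_consS.
  exact: (measurableT_comp (@measurable_coord _ _ _ j) measurable_snd).
by under eq_fun do rewrite rV_cons0; exact: measurable_fst.
Qed.

HB.instance Definition _ (d : nat) :=
  isMeasurableFun.Build _ _ _ _ (@rV_cons d) (@measurable_rV_cons d).

(* The uniform distribution on [0,1]^d, built as the d-fold product of the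
   uniform distribution on [0,1]; uniform_cubeE gives its value on boxes. *)
Fixpoint uniform_cube (d : nat) : probability 'rV[R]_d R :=
  match d with
  | 0 => (\d_(0 : 'rV[R]_0))
  | d'.+1 =>
      distribution
        (product_probability (uniform_prob (@ltr01 R)) (uniform_cube d'))
        (@rV_cons d')
  end.

End uniform_cube.

Lemma uniform_cubeE (R : realType) (d : nat) (A : 'I_d -> set R) :
  (forall i, measurable (A i)) ->
  uniform_cube d [set v : 'rV[R]_d | forall i, A i (v ord0 i)] =
  (\prod_(i < d) lebesgue_measure (A i `&` `[0%R, 1%R]))%E.
Proof.
elim: d A => [|d IHd] A mA.
  by rewrite big_ord0 /= diracE mem_set//= => -[].
rewrite big_ord_recl -IHd//.
set B := [set v : 'rV[R]_d | forall i : 'I_d, A (lift ord0 i) (v ord0 i)].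
have mB : measurable B.
  rewrite (_ : B = \bigcap_(i in setT)
      ((fun v : 'rV[R]_d => v ord0 i) @^-1` A (lift ord0 i))); last first.
    by apply/seteqP; split=> v /= H i; [move=> _|]; exact: H.
  apply: fin_bigcap_measurable => // i _.
  by rewrite -[X in measurable X]setTI; exact: measurable_coord.
transitivity ((uniform_prob (@ltr01 R) \x uniform_cube d)%E (A ord0 `*` B)).
  rewrite /= /distribution /pushforward /product_probability; congr (_ _).
  apply/seteqP; split=> -[x v] /=.
    move=> H; split=> [|i]; first by have := H ord0; rewrite rV_cons0.
    by have := H (lift ord0 i); rewrite rV_consS.
  move=> [H0 H] i; case: (unliftP ord0 i) => [j|] ->.
    by rewrite rV_consS; exact: H.
  by rewrite rV_cons0.
rewrite product_measure1E//; last exact: (mA ord0).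
congr (_ * _)%E.
rewrite /= /uniform_prob integral_uniform_pdf.
under eq_integral.
  move=> x; rewrite inE => -[_ /=]; rewrite in_itv/= => x01.
  rewrite /uniform_pdf x01 subr0 invr1; over.
rewrite integral_cst/= ?mul1e//.
by apply: measurableI; [exact: (mA ord0)|exact: measurable_itv].
Qed.

Section dual_quantization.
Context {R : realType} {d : nat}.
Implicit Types (N : 'rV[R]_d -> R) (p : R) (xi : 'rV[R]_d)
  (Gamma : {fset 'rV[R]_d}).

Definition barycentric_weights xi Gamma : set ('rV[R]_d -> R) :=
  [set lambda | [/\ {in Gamma, forall x, 0 <= lambda x <= 1},
                    \sum_(x <- Gamma) lambda x *: x = xi &
                    \sum_(x <- Gamma) lambda x = 1]].

(* F_p(xi; Gamma) for N, which is meant to be a norm; equal to +oo off the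
   convex hull of Gamma, where barycentric_weights is empty. *)
Definition dq_functional N p xi Gamma : \bar R :=
  ereal_inf [set ((\sum_(x <- Gamma) lambda x * N (xi - x) `^ p) `^ p^-1)%:E
            | lambda in barycentric_weights xi Gamma].

Definition dq_error N p (n : nat) (P : probability 'rV[R]_d R) : \bar R :=
  ereal_inf [set ((\int[P]_xi (dq_functional N p xi Gamma `^ p)) `^ p^-1)%E
            | Gamma in [set Gamma | Gamma != fset0 /\ (#|` Gamma| <= n)%N]].

(* Q^{dq}_{N,p,d}; an extended real, since the dq_error of uniform_cube is +oo
   for n <= d: fewer than d+1 points have a Lebesgue-null convex hull. *)
Definition dq_coefficient N p : \bar R :=
  ereal_inf [set ((n%:R `^ d%:R^-1)%:E * dq_error N p n (uniform_cube d))%E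
            | n in [set n | (1 <= n)%N]].

End dual_quantization.

Definition lr_norm (R : realType) (d : nat) (r : R) (x : 'rV[R]_d) : R :=
  (\sum_(i < d) `|x ord0 i| `^ r) `^ r^-1.

(* The absolute value on R, with R read as R^1. *)
Definition abs_norm (R : realType) (x : 'rV[R]_1) : R := `|x ord0 ord0|.

(* Main.v *)
Require Import Defs.
From mathcomp Require Import all_boot all_order all_algebra finmap.
From mathcomp Require Import all_classical all_reals all_analysis.
From mathcomp Require Import measurable_realfun.
From mathcomp Require Import ring.

Import Order.TTheory GRing.Theory Num.Theory.
Import numFieldNormedType.Exports.

Local Open Scope classical_set_scope.
Local Open Scope ring_scope.

(** The bound comes from product grids.  Let G be a set of at most m points of
    the line and let G^d be the grid it generates in R^d, which has at most m^d
    points; since (m^d)^(1/d) = m, it suffices to show that the error of G^d for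
    the uniform distribution on the cube is at most d^(1/r) times the error of
    G for the uniform distribution on [0,1].

    Fix xi in R^d.  If, for each i, the weights lambda_i on G have barycenter
    xi_i, then the products of the lambda_i are weights on G^d with barycenter
    xi (prod_weight_barycentric): they are the law of a random point X with
    independent coordinates, and only the marginals of this law matter.  As
    r <= p, the power mean inequality (powR_sum_le) gives
      |xi - X|_{l^r}^p <= d^(p/r - 1) sum_i |xi_i - X_i|^p.
    Taking expectations and minimizing over each lambda_i separately,
      F_p(xi; G^d)^p <= d^(p/r - 1) sum_i F_p(xi_i; G)^p   (min_cost_grid).
    Each coordinate of a uniform point of the cube is uniform on [0,1], so
    integrating this bound yields d^(p/r - 1) * d = d^(p/r) times the
    p-th power of the error of G (dq_error_grid), and the claim follows
    by taking p-th roots and infima over G and m.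

    Splitting the integral of the sum needs xi |-> F_p(xi; G)^p to be measurable
    on the line (measurable_min_cost1): its strict sublevel sets are countable
    unions of continuous images of compact sets of weights.  The left-hand
    integrand needs no measurability, since integrals of nonnegative functions
    are monotone without it. *)

Set Implicit Arguments.
Unset Strict Implicit.
Unset Printing Implicit Defensive.

(** * Powers and integrals *)

Lemma continuous_norm_powR (R : realType) (p : R) : 0 < p ->
  continuous (fun x : R => `|x| `^ p).
Proof.
move=> p0 x; have [->|x0] := eqVneq x 0.
  (* near 0, |y| < e^(1/p) implies |y|^p < e *)
  apply/cvgrPdist_lt => e e0; rewrite normr0 powR0 ?gt_eqF//.
  near=> y; rewrite sub0r normrN ger0_norm ?powR_ge0//.
  rewrite -[ltRHS](powRr1 (ltW e0)) -(mulVf (lt0r_neq0 p0)) powRrM.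
  rewrite gt0_ltr_powR ?nnegrE ?powR_ge0//.
  by near: y; apply: (@nbhs0_lt _ R^o); exact: powR_gt0.
apply: (@continuous_comp _ _ _ (fun y : R => `|y|) (@powR R ^~ p)).
  exact: norm_continuous.
apply: differentiable_continuous; apply/derivable1_diffP.
by apply: derivable_powR; rewrite in_itv/= andbT normr_gt0.
Unshelve. all: by end_near. Qed.

(** The power mean inequality, by induction on the number of terms: the step is
    the convexity of x |-> x^q. *)
Lemma powR_sum_le (R : realType) (q : R) (d : nat) (t : 'I_d -> R) :
  1 <= q -> (forall i, 0 <= t i) ->
  (\sum_i t i) `^ q <= d%:R `^ (q - 1) * \sum_i t i `^ q.
Proof.
move=> q1; have q0 : 0 < q by rewrite (lt_le_trans _ q1).
have natq k : k.+1%:R `^ q = k.+1%:R * k.+1%:R `^ (q - 1) :> R.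
  by rewrite -{2}(@powRr1 _ k.+1%:R)// -powRD ?pnatr_eq0 ?implybT// addrC subrK.
elim: d t => [|[_|d IHd]] t t0.
- by rewrite !big_ord0 powR0 ?gt_eqF// mulr0.
- by rewrite !big_ord1 powR1 mul1r.
rewrite big_ord_recr [X in _ <= _ * X]big_ord_recr/=.
set A := \sum_i _; set B := t ord_max; set S := \sum_i _.
have {IHd}AS : A `^ q <= d.+1%:R `^ (q - 1) * S by exact: IHd.
have A0 : 0 <= A by apply: sumr_ge0.
have n0 : 0 < d.+1%:R :> R by [].
have m0 : 0 < d.+2%:R :> R by [].
(* A + B = (d+2) (w (A / (d+1)) + (1 - w) B), to which convexity applies *)
pose w : R := d.+1%:R / d.+2%:R.
have w0 : 0 <= w by rewrite divr_ge0.
have w1 : w <= 1 by rewrite ler_pdivrMr// mul1r ler_nat.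
have wc : 1 - w = d.+2%:R^-1.
  rewrite -[X in X - _](mulfV (lt0r_neq0 m0)) -mulrBl -natrB ?leqnSn//.
  by rewrite subSnn mul1r.
have : (w * (A / d.+1%:R) + (1 - w) * B) `^ q
    <= w * (A / d.+1%:R) `^ q + (1 - w) * B `^ q.
  have := convex_powR q1 (Itv01 w0 w1) (x := A / d.+1%:R) (y := B).
  rewrite !convRE/= /unstable.onem; apply; rewrite inE/= in_itv/= andbT.
    exact: divr_ge0.
  exact: t0.
rewrite wc => /(ler_wpM2l (powR_ge0 d.+2%:R q)).
rewrite -powRM ?addr_ge0 ?mulr_ge0 ?divr_ge0 ?invr_ge0//; last exact: t0.
have -> : d.+2%:R * (w * (A / d.+1%:R) + d.+2%:R^-1 * B) = A + B.
  by rewrite /w; field; rewrite !gt_eqF.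
move=> /le_trans; apply.
rewrite natq -mulrA mulrCA ler_wpM2l ?powR_ge0//.
rewrite mulrDr mulVKf ?gt_eqF//.
rewrite lerD2r mulrA /w mulrCA mulfV ?gt_eqF// mulr1 powRM ?invr_ge0//.
rewrite -[_^-1]powR_inv1// powRAC powR_inv1 ?powR_ge0// natq.
rewrite mulrA ler_pdivrMr ?mulr_gt0 ?powR_gt0// mulrCA.
  by rewrite ler_pM2l// mulrC.
exact: ltW n0.
Qed.

(** The integral of a nonnegative function is a supremum over the simple
    functions below it, whether or not the function is measurable. *)
Lemma ge0_le_integral_nonmeasurable (d : measure_display)
    (T : measurableType d) (R : realType) (mu : {measure set T -> \bar R})
    (f g : T -> \bar R) :
  (forall x, 0 <= f x)%E -> (forall x, f x <= g x)%E ->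
  (\int[mu]_x f x <= \int[mu]_x g x)%E.
Proof.
move=> f0 fg; rewrite !ge0_integralTE//; last first.
  by move=> x; exact: le_trans (fg x).
apply: le_ereal_sup => _ [h hf <-]; exists h => // x.
exact: le_trans (hf x) (fg x).
Qed.

(** * The p-th power of the dual quantization functional *)

Section Cost.
Context {R : realType} {d : nat}.
Implicit Types (N : 'rV[R]_d -> R) (p : R) (xi : 'rV[R]_d)
  (Gamma : {fset 'rV[R]_d}).

(** The weighted sum of p-th powers of distances minimized by F_p. *)
Definition dq_cost N p xi Gamma (lambda : 'rV[R]_d -> R) : R :=
  \sum_(x <- Gamma) lambda x * N (xi - x) `^ p.

(** F_p(xi; Gamma)^p, see dq_functional_powE; it is +oo when xi has no
    barycentric weights. *)
Definition min_cost N p xi Gamma : \bar R :=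
  ereal_inf [set (dq_cost N p xi Gamma lambda)%:E
            | lambda in barycentric_weights xi Gamma].

Lemma dq_cost_ge0 N p xi Gamma lambda :
  barycentric_weights xi Gamma lambda -> 0 <= dq_cost N p xi Gamma lambda.
Proof.
move=> [l01 _ _]; rewrite /dq_cost big_seq; apply: sumr_ge0 => x xG.
by rewrite mulr_ge0 ?powR_ge0//; have /andP[] := l01 x xG.
Qed.

Lemma min_cost_ge0 N p xi Gamma : (0 <= min_cost N p xi Gamma)%E.
Proof.
by apply: le_ereal_inf_tmp => _ [l lG <-]; rewrite lee_fin dq_cost_ge0.
Qed.

Lemma dq_functional_powE N p xi Gamma : 0 < p ->
  (dq_functional N p xi Gamma `^ p)%E = min_cost N p xi Gamma.
Proof.
move=> p0; have pV0 : 0 <= p^-1 by rewrite invr_ge0 ltW.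
have F0 : (0 <= dq_functional N p xi Gamma)%E.
  by apply: le_ereal_inf_tmp => _ [l lG <-]; rewrite lee_fin powR_ge0.
have nneg (x : \bar R) : (0 <= x)%E -> x \in `[0%E, +oo%E].
  by move=> x0; rewrite in_itv/= x0 leey.
have powK (x : \bar R) : (0 <= x)%E -> ((x `^ p^-1) `^ p = x)%E.
  by move=> x0; rewrite -poweRrM mulVf ?lt0r_neq0// poweRe1.
apply/eqP; rewrite eq_le; apply/andP; split.
  apply: le_ereal_inf_tmp => _ [l lG <-].
  have c0 := dq_cost_ge0 N p lG.
  rewrite -[leRHS]powK ?lee_fin//.
  apply: gt0_ler_poweR; rewrite ?nneg ?poweR_ge0 ?(ltW p0)//.
  by apply: ereal_inf_lbound; exists l.
rewrite -[leLHS]powK ?min_cost_ge0//.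
apply: gt0_ler_poweR; rewrite ?nneg ?poweR_ge0 ?(ltW p0)//.
apply: le_ereal_inf_tmp => _ [l lG <-].
rewrite -poweR_EFin.
apply: gt0_ler_poweR; rewrite ?nneg ?min_cost_ge0 ?lee_fin ?dq_cost_ge0//.
by apply: ereal_inf_lbound; exists l.
Qed.

End Cost.

(** * Product grids *)

(** The point of R^d whose i-th coordinate is f i, read as a real number. *)
Definition grid_point {R : realType} (d : nat) (G : {fset 'rV[R]_1})
    (f : {ffun 'I_d -> G}) : 'rV[R]_d := \row_i (val (f i)) ord0 ord0.

(** The grid G^d, for a finite subset G of R^1. *)
Definition grid {R : realType} (d : nat) (G : {fset 'rV[R]_1}) :
    {fset 'rV[R]_d} :=
  [fset grid_point f | f in {: {ffun 'I_d -> G}}]%fset.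

Lemma row1_inj (R : realType) (x y : 'rV[R]_1) :
  x ord0 ord0 = y ord0 ord0 -> x = y.
Proof. by move=> xy; apply/rowP => i; rewrite !ord1. Qed.

Lemma grid_point_inj (R : realType) d (G : {fset 'rV[R]_1}) :
  injective (@grid_point R d G).
Proof.
move=> f g /rowP fg; apply/ffunP => i; apply/val_inj/row1_inj.
by have := fg i; rewrite !mxE.
Qed.

Lemma card_grid (R : realType) d (G : {fset 'rV[R]_1}) :
  #|` grid d G| = (#|` G| ^ d)%N.
Proof.
rewrite card_imfset/= ?cardfE; last exact: grid_point_inj.
by rewrite -cardE card_ffun card_ord.
Qed.

Lemma sum_grid (R : realType) d (G : {fset 'rV[R]_1}) (V : nmodType)
    (F : 'rV[R]_d -> V) :
  \sum_(x <- grid d G) F x = \sum_(f : {ffun 'I_d -> G}) F (grid_point f).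
Proof.
by rewrite big_imfset/= ?big_enum// => f g _ _; exact: grid_point_inj.
Qed.

(** The expectation of h (X_i) when X has independent coordinates, X_k having
    weights w k. *)
Lemma sum_prod_marginal (R : comNzSemiRingType) (I J : finType)
    (w : I -> J -> R) (h : J -> R) (i : I) :
  (forall k, \sum_j w k j = 1) ->
  \sum_(f : {ffun I -> J}) (\prod_k w k (f k)) * h (f i) =
  \sum_j w i j * h j.
Proof.
move=> w1; pose w' k j := if k == i then w k j * h j else w k j.
transitivity (\prod_k \sum_j w' k j).
  rewrite bigA_distr_bigA; apply: eq_bigr => f _.
  rewrite (bigD1 i)//= [in RHS](bigD1 i)//= /w' eqxx mulrAC; congr (_ * _).
  by apply: eq_bigr => k /negbTE ->.
rewrite (bigD1 i)//= [X in _ * X]big1 ?mulr1 => [|k ki].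
  by apply: eq_bigr => j _; rewrite /w' eqxx.
by rewrite -[RHS](w1 k); apply: eq_bigr => j _; rewrite /w' (negbTE ki).
Qed.

Lemma prod_itv01 (R : numDomainType) (I : finType) (w : I -> R) :
  (forall i, 0 <= w i <= 1) -> 0 <= \prod_i w i <= 1.
Proof.
move=> w01; rewrite prodr_ge0//=; last by move=> i _; have /andP[] := w01 i.
by apply: le_trans (ler_prod _ (fun i _ => w01 i)) _; rewrite big1.
Qed.

(** The product of weights lam i on R^1, as a weight on R^d. *)
Definition prod_weight {R : realType} d (lam : 'I_d -> 'rV[R]_1 -> R)
  (x : 'rV[R]_d) : R := \prod_i lam i (const_mx (x ord0 i)).

Lemma prod_weightE {R : realType} d (G : {fset 'rV[R]_1})
    (lam : 'I_d -> 'rV[R]_1 -> R) (f : {ffun 'I_d -> G}) :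
  prod_weight lam (grid_point f) = \prod_i lam i (val (f i)).
Proof.
by apply: eq_bigr => i _; congr lam; apply: row1_inj; rewrite !mxE.
Qed.

Lemma prod_weight_barycentric (R : realType) d (G : {fset 'rV[R]_1})
    (xi : 'rV[R]_d) (lam : 'I_d -> 'rV[R]_1 -> R) :
  (forall i, barycentric_weights (const_mx (xi ord0 i)) G (lam i)) ->
  barycentric_weights xi (grid d G) (prod_weight lam).
Proof.
move=> lamG; split.
- move=> _ /imfsetP[f _ ->]; rewrite prod_weightE; apply: prod_itv01 => i.
  by have [l01 _ _] := lamG i; exact/l01/fsvalP.
- apply/rowP => i; rewrite sum_grid summxE.
  under eq_bigr do rewrite mxE prod_weightE mxE.
  rewrite (@sum_prod_marginal _ _ _ (fun i (a : G) => lam i (val a))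
    (fun a : G => (val a) ord0 ord0)).
    have [_ + _] := lamG i => /rowP/(_ ord0); rewrite mxE => <-.
    by rewrite summxE big_seq_fsetE; apply: eq_bigr => a _; rewrite mxE.
  by move=> k; have [_ _] := lamG k; rewrite big_seq_fsetE.
- rewrite sum_grid; under eq_bigr do rewrite prod_weightE.
  rewrite -(bigA_distr_bigA (fun i (a : G) => lam i (val a))) big1// => i _.
  by have [_ _] := lamG i; rewrite big_seq_fsetE.
Qed.

Lemma lr_norm_pow_le (R : realType) (r p : R) d (x : 'rV[R]_d) :
  0 < r -> r <= p ->
  lr_norm r x `^ p <= d%:R `^ (p / r - 1) * \sum_i `|x ord0 i| `^ p.
Proof.
move=> r0 rp; rewrite /lr_norm -powRrM mulrC.
apply: le_trans (powR_sum_le _ _) _.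
- by rewrite ler_pdivlMr// mul1r.
- by move=> i; exact: powR_ge0.
rewrite ler_wpM2l ?powR_ge0//; apply: ler_sum => i _.
by rewrite -powRrM mulrCA mulfV ?lt0r_neq0// mulr1.
Qed.

Lemma prod_weight_cost (R : realType) (r p : R) d (G : {fset 'rV[R]_1})
    (xi : 'rV[R]_d) (lam : 'I_d -> 'rV[R]_1 -> R) : 0 < r -> r <= p ->
  (forall i, barycentric_weights (const_mx (xi ord0 i)) G (lam i)) ->
  dq_cost (@lr_norm R d r) p xi (grid d G) (prod_weight lam) <=
  d%:R `^ (p / r - 1) *
    \sum_i dq_cost (@abs_norm R) p (const_mx (xi ord0 i)) G (lam i).
Proof.
move=> r0 rp lamG; rewrite /dq_cost sum_grid.
pose w (f : {ffun 'I_d -> G}) := \prod_i lam i (val (f i)).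
apply: (@le_trans _ _ (\sum_f w f * (d%:R `^ (p / r - 1) *
    \sum_i `|xi ord0 i - (val (f i)) ord0 ord0| `^ p))).
  apply: ler_sum => f _; rewrite prod_weightE ler_wpM2l//.
    by apply: prodr_ge0 => i _; have [/(_ _ (fsvalP (f i)))/andP[]] := lamG i.
  apply: le_trans (lr_norm_pow_le _ r0 rp) _.
  rewrite ler_wpM2l ?powR_ge0//; apply: ler_sum => i _.
  by rewrite !mxE.
under eq_bigr do rewrite mulrCA; rewrite -mulr_sumr ler_wpM2l ?powR_ge0//.
under eq_bigr do rewrite mulr_sumr; rewrite exchange_big/=.
apply: ler_sum => i _.
rewrite (@sum_prod_marginal _ _ _ (fun i (a : G) => lam i (val a))
  (fun a : G => `|xi ord0 i - (val a) ord0 ord0| `^ p)).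
  rewrite big_seq_fsetE; apply: ler_sum => a _.
  by rewrite /abs_norm !mxE.
by move=> k; have [_ _] := lamG k; rewrite big_seq_fsetE.
Qed.

Lemma min_cost_grid (R : realType) (r p : R) d (G : {fset 'rV[R]_1})
    (xi : 'rV[R]_d) : (0 < d)%N -> 0 < r -> r <= p ->
  (min_cost (@lr_norm R d r) p xi (grid d G) <=
   (d%:R `^ (p / r - 1))%:E *
    \sum_i min_cost (@abs_norm R) p (const_mx (xi ord0 i)) G)%E.
Proof.
move=> d0 r0 rp.
have K0 : 0 < d%:R `^ (p / r - 1) :> R by rewrite powR_gt0 ?ltr0n.
pose C i := min_cost (@abs_norm R) p (const_mx (xi ord0 i)) G.
change (min_cost (@lr_norm R d r) p xi (grid d G) <=
   (d%:R `^ (p / r - 1))%:E * \sum_i C i)%E.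
have C0 i : (0 <= C i)%E by exact: min_cost_ge0.
have [/forallP Cfin|] := boolP [forall i, C i \is a fin_num]; last first.
  (* the right-hand side is +oo as soon as one of the C i is *)
  rewrite negb_forall => /existsP[i].
  rewrite ge0_fin_numE// -leNgt leye_eq => /eqP Ci.
  have S0 : (0 <= \sum_(j | j != i) C j)%E by apply: sume_ge0.
  rewrite (bigD1 i)//= Ci addye; last by rewrite gt_eqF// (lt_le_trans _ S0).
  by rewrite gt0_muley ?lte_fin// leey.
(* choose weights with cost at most C i + e' in every coordinate; the total
   excess is then e *)
apply/lee_addgt0Pr => e e0.
pose e' := e / (d%:R `^ (p / r - 1) * d%:R).
have e'0 : 0 < e' by rewrite divr_gt0 ?mulr_gt0 ?ltr0n.
have /choice[lam lamP] (i : 'I_d) : exists l,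
    barycentric_weights (const_mx (xi ord0 i)) G l /\
    ((dq_cost (@abs_norm R) p (const_mx (xi ord0 i)) G l)%:E <= C i + e'%:E)%E.
  have [_ [l lG <-] /ltW ?] := lb_ereal_inf_adherent e'0 (Cfin i).
  by exists l.
apply: (@le_trans _ _
    (dq_cost (@lr_norm R d r) p xi (grid d G) (prod_weight lam))%:E).
  apply: ereal_inf_lbound; exists (prod_weight lam) => //.
  by apply: prod_weight_barycentric => i; have [] := lamP i.
apply: (@le_trans _ _ ((d%:R `^ (p / r - 1))%:E * \sum_i (C i + e'%:E))%E).
  apply: (@le_trans _ _ (d%:R `^ (p / r - 1) *
    \sum_i dq_cost (@abs_norm R) p (const_mx (xi ord0 i)) G (lam i))%:E).
    by rewrite lee_fin prod_weight_cost// => i; have [] := lamP i.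
  rewrite EFinM lee_wpmul2l ?lee_fin ?powR_ge0// -sumEFin.
  by apply: lee_sum => i _; have [] := lamP i.
rewrite big_split/= sumEFin sumr_const card_ord.
rewrite ge0_muleDr ?sume_ge0 ?lee_fin ?mulrn_wge0 ?(ltW e'0)//.
rewrite -EFinM -[e' *+ d]mulr_natr mulrCA divfK//.
by rewrite mulf_neq0// ?lt0r_neq0// ?ltr0n.
Qed.

(** * Measurability on the line and integration over the cube *)

(** The sets {C < r} are measurable: they are the unions over n of the sets of
    barycenters of the weights of cost at most r - 1/(n+1). The weights take
    values in [0,1] on the whole of R^1, so they form a closed subset K n of a
    cube that is compact by Tychonoff's theorem, and the barycenter depends
    continuously on them. *)
Lemma measurable_min_cost1 (R : realType) (p : R) (G : {fset 'rV[R]_1}) :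
  0 < p -> measurable_fun [set: measurableTypeR R]
    (fun x : R => min_cost (@abs_norm R) p (const_mx x) G).
Proof.
move=> p0.
apply: (measurability _ (ErealGenInftyO.measurableE R)) => _ /= -[_ [r ->] <-].
rewrite setTI.
pose W := prod_topology (fun _ : 'rV[R]_1 => R).
pose E : set W := [set l | forall x, `[0, 1]%classic (l x)].
have cE : compact E.
  exact: (@tychonoff _ (fun=> R) (fun=> `[0, 1]%classic)
    (fun=> @segment_compact R 0 1)).
have cproj x : continuous (fun l : W => l x : R).
  exact: (@proj_continuous _ (fun=> R) x).
pose bary (l : W) : R := \sum_(x <- G) l x * x ord0 ord0.
pose tot (l : W) : R := \sum_(x <- G) l x.
pose cst (l : W) : R := \sum_(x <- G) l x * `|bary l - x ord0 ord0| `^ p.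
have csum (F : 'rV[R]_1 -> W -> R) : (forall x, continuous (F x)) ->
    continuous (fun l => \sum_(x <- G) F x l).
  move=> cF; apply: (@continuous_big R^o _ +%R) => //.
  exact: add_continuous.
have cM (f g : W -> R) : continuous f -> continuous g ->
    continuous (fun l => f l * g l).
  by move=> cf cg l; exact: cvgM (cf l) (cg l).
have ctot : continuous tot by exact: csum.
have cbary : continuous bary.
  apply: (csum (fun x l => l x * x ord0 ord0)) => x.
  apply: (cM (fun l => l x) (fun=> x ord0 ord0)) => //.
  exact: (@cst_continuous W R^o).
have ccst : continuous cst.
  apply: (csum (fun x l => l x * `|bary l - x ord0 ord0| `^ p)) => x.
  apply: (cM (fun l => l x) (fun l => `|bary l - x ord0 ord0| `^ p)) => //.
  move=> l; apply: (@continuous_comp W R R (fun l => bary l - x ord0 ord0)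
    (fun y : R => `|y| `^ p)); last exact: continuous_norm_powR.
  exact: cvgB (cbary l) (cvg_cst _).
pose K n :=
  E `&` (tot @^-1` [set 1] `&` cst @^-1` [set y | y <= r - n.+1%:R^-1]).
have cK n : compact (K n).
  apply: compact_closedI => //; apply: closedI.
    by apply: closed_comp => [l _|]; [exact: ctot|exact: closed_eq].
  by apply: closed_comp => [l _|]; [exact: ccst|exact: closed_le].
rewrite [X in measurable X](_ : _ = \bigcup_n (bary @` K n)).
  apply: bigcup_measurable => n _; apply: closed_measurable.
  apply: compact_closed; first exact: Rhausdorff.
  apply: continuous_compact => //; exact: continuous_subspaceT.
apply/seteqP; split => x /=.
  rewrite in_itv/= => /ereal_inf_lt[_ [l [l01 lx l1] <-]].
  rewrite lte_fin => /ltr_add_invr[n nr].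
  (* l is only constrained on G; K n requires values in [0,1] everywhere *)
  pose l' y := if y \in G then l y else 0.
  have l'E y : y \in G -> l' y = l y by rewrite /l' => ->.
  have barE : bary l' = x.
    move/rowP : lx => /(_ ord0); rewrite mxE summxE => <-.
    by rewrite /bary !big_seq; apply: eq_bigr => y /l'E ->; rewrite mxE.
  exists n => //; exists l' => //; split.
    move=> y; rewrite /= in_itv/= /l'; case: ifPn => [/l01//|_].
    by rewrite lexx ler01.
  split; rewrite /=.
    by rewrite -l1 /tot !big_seq; apply: eq_bigr => y /l'E ->.
  rewrite lerBrDr; apply: le_trans (ltW nr); rewrite lerD2r.
  rewrite /cst barE /dq_cost !big_seq; apply: ler_sum => y /l'E ->.
  by rewrite /abs_norm !mxE.
move=> [n _ [l [lE [l1 lr]] <-]]; rewrite in_itv/=.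
apply: (@le_lt_trans _ _ (cst l)%:E); last first.
  by rewrite lte_fin (le_lt_trans lr)// gtrBl.
apply: ereal_inf_lbound; exists l; last first.
  by congr EFin; apply: eq_bigr => y _; rewrite /abs_norm !mxE.
split=> //.
- by move=> y _; have := lE y; rewrite /= in_itv.
- apply/rowP => i; rewrite ord1 !mxE summxE; apply: eq_bigr => y _.
  by rewrite mxE.
Qed.


Lemma uniform_cube_coord (R : realType) d (i : 'I_d) (A : set R) :
  measurable A ->
  uniform_cube d [set v : 'rV[R]_d | A (v ord0 i)] =
  lebesgue_measure (A `&` `[0, 1]%classic).
Proof.
move=> mA; pose B k := if k == i then A else setT.
have mB k : measurable (B k) by rewrite /B; case: ifP.
have -> : [set v : 'rV[R]_d | A (v ord0 i)] =
    [set v | forall k, B k (v ord0 k)].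
  apply/seteqP; split => v /= => [Av k|/(_ i)]; rewrite /B ?eqxx//.
  by case: eqP => // ->.
rewrite uniform_cubeE// (bigD1 i)//= big1 ?mule1 ?/B ?eqxx// => k ki.
by rewrite (negbTE ki) setTI lebesgue_measure_itv/= lte01 sube0.
Qed.

Lemma integral_uniform_cube_coord (R : realType) d (i : 'I_d)
    (g : measurableTypeR R -> \bar R) :
  measurable_fun setT g -> (forall x, 0 <= g x)%E ->
  (\int[uniform_cube d]_v g (v ord0 i) =
   \int[uniform_cube 1]_v g (v ord0 ord0))%E.
Proof.
move=> mg g0.
have pf n (j : 'I_n) : (\int[uniform_cube n]_v g (v ord0 j) =
    \int[pushforward (uniform_cube n) (fun v => v ord0 j)]_y g y)%E.
  by rewrite (@ge0_integral_pushforward _ _ _ _ _ _ (measurable_coord j)).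
rewrite !pf; apply: eq_measure_integral; [exact: measurable_coord..|].
move=> mi m0 A mA _.
by transitivity (lebesgue_measure (A `&` `[0%R, 1%R]%classic));
  [|symmetry]; exact: uniform_cube_coord.
Qed.

(** * The inequality between the coefficients *)

(** The error of the grid G^d on the cube is at most d^(1/r) times the error of
    G on [0,1]. *)
Lemma dq_error_grid (R : realType) (r p : R) d (G : {fset 'rV[R]_1}) :
  (0 < d)%N -> 1 <= r -> r <= p ->
  ((\int[uniform_cube d]_xi
      (dq_functional (@lr_norm R d r) p xi (grid d G) `^ p)) `^ p^-1 <=
   (d%:R `^ r^-1)%:E *
   (\int[uniform_cube 1]_xi
      (dq_functional (@abs_norm R) p xi G `^ p)) `^ p^-1)%E.
Proof.
move=> d0 r1 rp; have r0 : 0 < r by exact: lt_le_trans r1.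
have p0 : 0 < p by exact: lt_le_trans rp.
have dn0 : (d%:R : R) != 0 by rewrite pnatr_eq0 -lt0n.
pose C x := min_cost (@abs_norm R) p (const_mx x) G.
have mC : measurable_fun [set: measurableTypeR R] C.
  exact: measurable_min_cost1.
have C0 x : (0 <= C x)%E by exact: min_cost_ge0.
set J := (\int[uniform_cube 1]_xi _)%E.
have JE : J = (\int[uniform_cube 1]_v C (v ord0 ord0))%E.
  apply: eq_integral => v _; rewrite dq_functional_powE//; congr min_cost.
  by apply: row1_inj; rewrite mxE.
have J0 : (0 <= J)%E by rewrite JE; exact: integral_ge0.
have mCi (i : 'I_d) : measurable_fun [set: 'rV[measurableTypeR R]_d]
    (fun v => C (v ord0 i)).
  exact: (measurableT_comp mC (@measurable_coord _ _ _ i)).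
have IJ : (\int[uniform_cube d]_xi
      (dq_functional (@lr_norm R d r) p xi (grid d G) `^ p) <=
    (d%:R `^ (p / r))%:E * J)%E.
  apply: (@le_trans _ _ (\int[uniform_cube d]_v
     ((d%:R `^ (p / r - 1))%:E * \sum_i C (v ord0 i)))%E).
    apply: ge0_le_integral_nonmeasurable => v; first exact: poweR_ge0.
    by rewrite dq_functional_powE// min_cost_grid.
  rewrite ge0_integralZl//=; first last.
  - by move=> v _; exact: sume_ge0.
  - exact: emeasurable_sum.
  rewrite ge0_integral_sum//.
  under eq_bigr do rewrite integral_uniform_cube_coord// -JE.
  rewrite sumr_const card_ord -[(J *+ d)%R]mule_natl muleA -EFinM.
  by rewrite -[X in _ * X]powRr1// -powRD ?dn0 ?implybT// subrK.
apply: (@le_trans _ _ (((d%:R `^ (p / r))%:E * J) `^ p^-1)%E).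
  apply: gt0_ler_poweR => //; rewrite ?invr_ge0 ?(ltW p0)//.
    by rewrite in_itv/= leey integral_ge0// => v _; exact: poweR_ge0.
  by rewrite in_itv/= leey mule_ge0// lee_fin powR_ge0.
rewrite poweRM ?lee_fin ?powR_ge0// poweR_EFin -powRrM.
by rewrite mulrAC mulfV ?lt0r_neq0// mul1r.
Qed.

Unset Implicit Arguments.

Theorem proposition1 (R : realType) (r p : R)
    (hr : 1 <= r) (hp : 1 <= p) (hrp : r <= p) (d : nat) (hd : (1 <= d)%N) :
  (dq_coefficient (@lr_norm R d r) p
     <= (d%:R `^ r^-1)%:E * dq_coefficient (@abs_norm R) p)%E.
Proof.
have K0 : 0 < d%:R `^ r^-1 :> R by rewrite powR_gt0 ?ltr0n.
rewrite -lee_pdivrMl//; apply/ereal_infP => _ [m m1 <-].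
have m0 : 0 < m%:R :> R by rewrite ltr0n.
rewrite lee_pdivrMl// invr1 powRr1 ?(ltW m0)// muleCA -lee_pdivrMl//.
rewrite -lee_pdivrMl//; apply/ereal_infP => _ [G [G0 Gm] <-].
rewrite !lee_pdivrMl//.
apply: le_trans (lee_wpmul2l _ (dq_error_grid G hd hr hrp)); last first.
  by rewrite lee_fin ltW.
(* the grid has at most m ^ d points, and (m ^ d)^(1/d) = m *)
apply: (@le_trans _ _ (((m ^ d)%N%:R `^ d%:R^-1)%:E *
    dq_error (@lr_norm R d r) p (m ^ d) (uniform_cube d))%E).
  by apply: ereal_inf_lbound; exists (m ^ d)%N => //=; rewrite expn_gt0 m1.
rewrite natrX -powR_mulrn ?(ltW m0)// -powRrM mulfV ?pnatr_eq0 -?lt0n//.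
rewrite powRr1 ?(ltW m0)//.
apply: lee_wpmul2l; first by rewrite lee_fin ltW.
apply: ereal_inf_lbound; exists (grid d G) => //; split.
  by rewrite -cardfs_gt0 card_grid expn_gt0 cardfs_gt0 G0.
by rewrite card_grid leq_exp2r.
Qed.
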